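(* For all integers $J\ge 0$ and $N\ge 0$, $$MO(1,3J+3;3N+1)\equiv MO(1,3J+2;3N+1)\equiv 0\pmod 3.$$
   Context: For an integer $a$ and a nonnegative integer $t$, define $MO(a,t;n)$ by the formal power series identity $$\sum_{n\ge 0}MO(a,t;n)\,q^n=\sum_{1\le n_1<n_2<\cdots<n_t}\frac{q^{n_1+n_2+\cdots+n_t}}{\prod_{k=1}^t(1+aq^{n_k}+q^{2n_k})},$$ where each factor $1/(1+aq^{m}+q^{2m})$ is expanded as a power series in $q$ with integer coefficients. *)

(* Defs.v *)
From HB Require Import structures.
From mathcomp Require Import all_boot all_order all_algebra.
From mathcomp Require Import boolp classical_sets functions cardinality fsbigop.

Set Implicit Arguments.
Unset Strict Implicit.
Unset Printing Implicit Defensive.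

Import GRing.Theory.
Local Open Scope ring_scope.

(* The ring R[[q]] of formal power series.  The wrapper keeps its Cauchy
   product apart from the pointwise ring structure on [nat -> R]. *)
Record fps (R : Type) := Fps { fps_coef :> nat -> R }.

HB.instance Definition _ (R : Type) := [isNew for @fps_coef R].
HB.instance Definition _ (R : choiceType) := [Choice of fps R by <:].

Lemma fpsP (R : Type) (f g : fps R) : (forall n, f n = g n) -> f = g.
Proof. by case: f g => [f] [g] /= /funext ->. Qed.

Section Ring.
Variable R : comUnitRingType.
Implicit Types f g h : fps R.

Definition fps_const (c : R) : fps R := Fps (fun n => if n == 0%N then c else 0).
Definition fps_opp f : fps R := Fps (fun n => - f n).
Definition fps_add f g : fps R := Fps (fun n => f n + g n).
Definition fps_mul f g : fps R :=
  Fps (fun n => \sum_(i < n.+1) f i * g (n - i)%N).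

Fact fps_addA : associative fps_add.
Proof. by move=> f g h; apply: fpsP => n /=; rewrite addrA. Qed.
Fact fps_addC : commutative fps_add.
Proof. by move=> f g; apply: fpsP => n /=; rewrite addrC. Qed.
Fact fps_add0 : left_id (fps_const 0) fps_add.
Proof. by move=> f; apply: fpsP => n /=; rewrite if_same add0r. Qed.
Fact fps_addN : left_inverse (fps_const 0) fps_opp fps_add.
Proof. by move=> f; apply: fpsP => n /=; rewrite if_same addNr. Qed.

HB.instance Definition _ := GRing.isZmodule.Build (fps R)
  fps_addA fps_addC fps_add0 fps_addN.

Definition fps_trunc N f : {poly R} := \poly_(i < N) f i.

Fact fps_mul_trunc N f g n : (n < N)%N ->
  fps_mul f g n = (fps_trunc N f * fps_trunc N g)`_n.
Proof.
move=> nN; rewrite coefM; apply: eq_bigr => i _; rewrite !coef_poly.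
rewrite (leq_ltn_trans _ nN) ?(leq_ltn_trans _ nN) ?leq_subr //.
by rewrite -ltnS.
Qed.

Fact fps_mulC : commutative fps_mul.
Proof.
by move=> f g; apply: fpsP => n; rewrite !(fps_mul_trunc _ _ (ltnSn n)) mulrC.
Qed.

Fact fps_mulA : associative fps_mul.
Proof.
have E f g h n : fps_mul (fps_mul f g) h n
    = (fps_trunc n.+1 f * fps_trunc n.+1 g * fps_trunc n.+1 h)`_n.
  rewrite coefM; apply: eq_bigr => i _.
  by rewrite (fps_mul_trunc _ _ (ltn_ord i)) coef_poly ltnS leq_subr.
move=> f g h; apply: fpsP => n.
by rewrite fps_mulC !E; congr (_`_n); rewrite mulrC mulrA.
Qed.

Fact fps_mul1 : left_id (fps_const 1) fps_mul.
Proof.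
move=> f; apply: fpsP => n /=; rewrite big_ord_recl /= mul1r subn0.
by rewrite big1 ?addr0 // => i _; rewrite mul0r.
Qed.

Fact fps_mulD : left_distributive fps_mul fps_add.
Proof.
move=> f g h; apply: fpsP => n /=; rewrite -big_split /=.
by apply: eq_bigr => i _; rewrite mulrDl.
Qed.

Fact fps_one_neq0 : fps_const 1 != 0.
Proof.
apply/eqP => /(congr1 (fun f : fps R => f 0%N)) /= /eqP.
by rewrite oner_eq0.
Qed.

HB.instance Definition _ := GRing.Zmodule_isComNzRing.Build (fps R)
  fps_mulA fps_mulC fps_mul1 fps_mulD fps_one_neq0.

Lemma fpsM f g n : (f * g) n = \sum_(i < n.+1) f i * g (n - i)%N.
Proof. by []. Qed.

Lemma fpsB f g n : (f - g) n = f n - g n.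
Proof. by []. Qed.

Lemma fps1 n : (1 : fps R) n = if n == 0%N then 1 else 0.
Proof. by []. Qed.

Lemma fps_bigE (I : Type) (r : seq I) (P : pred I) (F : I -> fps R) n :
  (\sum_(i <- r | P i) F i) n = \sum_(i <- r | P i) F i n.
Proof.
by apply: (big_morph (fun f : fps R => f n)) => //=; rewrite if_same.
Qed.

Lemma fpsX_lt f k n : f 0%N = 0 -> (n < k)%N -> (f ^+ k) n = 0.
Proof.
move=> f0; elim: k n => // k IH n nk; rewrite exprS fpsM.
rewrite big1 // => -[[|i] /= ip] _; first by rewrite f0 mul0r.
case: n nk ip => [//|n] nk _; rewrite IH ?mulr0 // subSS.
by rewrite (leq_ltn_trans (leq_subr _ _)) // -ltnS.
Qed.

Definition fps_unit : {pred fps R} := fun f => f 0%N \is a GRing.unit.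

(* With c the constant term of f and u := 1 - f / c, the inverse of f is
   c^-1 * \sum_k u ^+ k; as u has no constant term, only the k <= n
   contribute to the coefficient of q^n. *)
Definition fps_inv f : fps R :=
  if f 0%N \is a GRing.unit then
    let d := fps_const (f 0%N)^-1 in
    d * Fps (fun n => (\sum_(k < n.+1) (1 - d * f) ^+ k) n)
  else f.

Fact fps_mulVx : {in fps_unit, left_inverse 1 fps_inv *%R}.
Proof.
move=> f; rewrite unfold_in => fU; rewrite /fps_inv fU.
set d := fps_const _; set u := 1 - d * f; set S := Fps _ => /=.
have u0 : u 0%N = 0.
  by rewrite fpsB fpsM big_ord1 fps1 /= subnn mulVr // subrr.
rewrite mulrC mulrA [f * d]mulrC (_ : d * f = 1 - u); last by rewrite subKr.
apply: fpsP => n; have -> : ((1 - u) * S) n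
    = ((1 - u) * \sum_(k < n.+1) u ^+ k) n.
  rewrite !fpsM; apply: eq_bigr => i _; congr (_ * _) => /=.
  rewrite !fps_bigE -(big_mkord xpredT (fun k => (u ^+ k) (n - i)%N)).
  rewrite -(big_mkord xpredT (fun k => (u ^+ k) (n - i)%N)).
  rewrite [RHS](@big_cat_nat _ _ _ (n - i).+1) ?ltnS ?leq_subr //=.
  rewrite [X in _ = _ + X]big_nat_cond [X in _ = _ + X]big1 ?addr0 //.
  by move=> k /andP[/andP[ik _] _]; rewrite fpsX_lt.
by rewrite -opprB mulNr -subrX1 opprB fpsB (fpsX_lt u0 (ltnSn n)) subr0.
Qed.

Fact fps_unitPl f g : g * f = 1 -> fps_unit f.
Proof.
move=> /(congr1 (fun f : fps R => f 0%N)).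
rewrite fpsM big_ord1 subnn fps1 /= => gf; apply/unitrP.
by exists (g 0%N); split=> //; rewrite mulrC.
Qed.

Fact fps_inv_out : {in [predC fps_unit], fps_inv =1 id}.
Proof. by move=> f; rewrite inE unfold_in /fps_inv => /negPf ->. Qed.

HB.instance Definition _ := GRing.ComNzRing_hasMulInverse.Build (fps R)
  fps_mulVx fps_unitPl fps_inv_out.

Definition fps_q : fps R := Fps (fun n => if n == 1%N then 1 else 0).

Lemma fps_qXM k f n : (fps_q ^+ k * f) n = if (n < k)%N then 0 else f (n - k)%N.
Proof.
elim: k n => [|k IH] n; first by rewrite mul1r subn0.
rewrite exprS -mulrA fpsM; case: n => [|n].
  by rewrite big_ord1 /= mul0r.
rewrite 2!big_ord_recl big1 => [|i _] /=; last by rewrite mul0r.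
rewrite mul0r add0r mul1r addr0 subn1 -[LHS]/((fps_q ^+ k * f) n).
by rewrite IH ltnS subSS.
Qed.

(* Coefficientwise sum of a family of power series.  It is meaningful when
   each power of q occurs in only finitely many [F i]: a finitely supported
   sum [\sum_(i \in D) _] with infinite support is 0 by convention. *)
Definition fps_sum (I : choiceType) (D : set I) (F : I -> fps R) : fps R :=
  Fps (fun n => \sum_(i \in D) F i n).

End Ring.

Definition MO_index (t : nat) : set (t.-tuple nat) :=
  [set s : t.-tuple nat | path ltn 0%N s]%classic.

Definition MO_term (a : int) (t : nat) (s : t.-tuple nat) : fps int :=
  let q := fps_q int in
  q ^+ (\sum_(m <- s) m)%N / \prod_(m <- s) (1 + a%:~R * q ^+ m + q ^+ (2 * m)).

Definition MO_gf (a : int) (t : nat) : fps int :=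
  fps_sum (@MO_index t) (@MO_term a t).

Definition MO (a : int) (t n : nat) : int := MO_gf a t n.

Lemma MO_term_lt (a : int) (t n : nat) (s : t.-tuple nat) :
  (n < \sum_(m <- s) m)%N -> MO_term a s n = 0.
Proof. by move=> ns; rewrite /MO_term fps_qXM ns. Qed.

(* The sum in [MO_gf] is never the default value 0 of an infinite sum. *)
Lemma MO_summable (a : int) (t n : nat) :
  finite_set (@MO_index t `&` [set s | MO_term a s n != 0])%classic.
Proof.
have fin : finite_set [set: t.-tuple 'I_n.+1]%classic by exact: finite_finset.
pose F (u : t.-tuple 'I_n.+1) : t.-tuple nat := [tuple of map val u].
apply: (@sub_finite_set _ _ (F @` setT)%classic _ (finite_image F fin)).
move=> s [_ sN0]; have [/(MO_term_lt a) s0|sn] := ltnP n (\sum_(m <- s) m)%N.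
  by case/eqP: sN0.
exists [tuple of map inord s] => //; apply: val_inj => /=.
rewrite -map_comp -[RHS]map_id; apply/eq_in_map => m ms /=.
by rewrite inordK // ltnS (leq_trans _ sn) // (big_rem m) //= leq_addr.
Qed.

(* The denominators are units, so their inverse is not the default one. *)
Lemma MO_denom_unit (a : int) (m : nat) : (0 < m)%N ->
  1 + a%:~R * fps_q int ^+ m + fps_q int ^+ (2 * m) \is a GRing.unit.
Proof.
have E k (f : fps int) : (0 < k)%N -> (fps_q int ^+ k * f) 0%N = 0.
  by move=> k0; rewrite fps_qXM k0.
move=> m0; set f := (X in X \is a _).
suff f0 : f 0%N = 1 by change (f 0%N \is a GRing.unit); rewrite f0 unitr1.
change (1 + (a%:~R * fps_q int ^+ m) 0%N + (fps_q int ^+ (2 * m)) 0%N = 1).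
by rewrite mulrC -[_ ^+ (2 * m)]mulr1 !E ?addr0 // muln_gt0.
Qed.

(* Main.v *)
From HB Require Import structures.
Require Import Defs.
From mathcomp Require Import all_boot all_order all_algebra.
From mathcomp Require Import classical_sets fsbigop.
From mathcomp Require Import zify ring.

(* Put y = - (1 + x).  Multiplying the generating function
     \sum_t x^t \sum_n MO(1,t;n) q^n
       = \prod_i (1 - y q^i + q^(2i)) / (1 + q^i + q^(2i))
   by D = \prod_i (1 - q^(3i)) = \prod_i (1 - q^i) (1 + q^i + q^(2i)) gives,
   by Jacobi's triple product identity with y = z + 1/z,
     \prod_i (1 - q^i) (1 - y q^i + q^(2i))
       = \sum_n (-1)^n q^(n(n+1)/2) V_n(y),  V_n = z^(-n) + ... + z^n.
   The exponent n(n+1)/2 is a multiple of 3 unless n = 1 mod 3, and modulo 3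
   V_(3m+1)(y) = (z + 1 + 1/z) V_m(z^3) = - x V_m(z^3) only involves the powers
   x^t with t = 1 mod 3.  For the other t, the coefficient of x^t is thus a
   series in q^3, and dividing by D, itself a series in q^3, preserves this. *)

Set Implicit Arguments.
Unset Strict Implicit.
Unset Printing Implicit Defensive.

Import GRing.Theory.
Local Open Scope ring_scope.

(** * Gaussian binomial coefficients over a commutative ring *)

Section GaussianBinomial.
Variables (R : comNzRingType) (q : R).

Fixpoint qbinom (n k : nat) : R :=
  match n, k with
  | _, 0%N => 1
  | 0%N, _.+1 => 0
  | n'.+1, k'.+1 => qbinom n' k' + q ^+ k'.+1 * qbinom n' k'.+1
  end.

Lemma qbinom0 n : qbinom n 0 = 1.
Proof. by case: n. Qed.

Lemma qbinomS n k :
  qbinom n.+1 k.+1 = qbinom n k + q ^+ k.+1 * qbinom n k.+1.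
Proof. by []. Qed.

Lemma qbinom_small n k : (n < k)%N -> qbinom n k = 0.
Proof.
by elim: n k => [|n IH] [|k] //= nk; rewrite !IH ?mulr0 ?addr0 // ltnW.
Qed.

(** The second q-Pascal rule. Inductively, the two terms of the first rule are expanded by the
    second and regrouped by the first; writing [k + j] keeps truncated subtraction out of the
    exponent. *)
Lemma qbinomS_alt j k :
  qbinom (k + j).+1 k.+1 = q ^+ j * qbinom (k + j) k + qbinom (k + j) k.+1.
Proof.
move: {2}(k + j)%N (erefl (k + j)%N) => n En.
elim: n k j En => [|n IH] [|k] j // En.
- by case: j En => //= _; rewrite mulr0 !addr0 mulr1.
- case: j En => [|j] // [En].
  rewrite add0n qbinomS !qbinom0 -[j.+1]add0n qbinomS !qbinom0.
  have := IH 0%N j; rewrite add0n En qbinomS => /(_ erefl).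
  rewrite !qbinom0 add0n expr1 exprS mulr1 => E.
  have -> : q ^+ n = 1 + q * qbinom n 1 - qbinom n 1 by rewrite E addrK.
  by ring.
- case: j En => [|j] En.
    by rewrite addn0 qbinomS !(@qbinom_small k.+1 k.+2) //; ring.
  have E : (k + j.+1)%N = (k.+1 + j)%N by rewrite addnS.
  have E1 : qbinom (k + j.+1).+1 k.+1
    = q ^+ j.+1 * qbinom (k + j.+1) k + qbinom (k + j.+1) k.+1.
    by apply: IH; lia.
  have E2 : qbinom (k + j.+1).+1 k.+2
    = q ^+ j * qbinom (k + j.+1) k.+1 + qbinom (k + j.+1) k.+2.
    by rewrite E; apply: IH; lia.
  rewrite addSn qbinomS {1}E1 {1}E2 (qbinomS _ k) (qbinomS _ k.+1) !exprS; ring.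
Qed.

Lemma qbinom_diag n : qbinom n n = 1.
Proof.
by elim: n => // n IH; rewrite qbinomS IH qbinom_small // mulr0 addr0.
Qed.

(** Complementing the lower index exchanges the two q-Pascal rules. *)
Lemma qbinom_sym i j : qbinom (i + j) i = qbinom (i + j) j.
Proof.
move: {2}(i + j)%N (erefl (i + j)%N) => n En.
elim: n i j En => [|n IH] [|i] [|j] // En;
  rewrite ?addn0 ?add0n ?qbinom0 ?qbinom_diag //.
rewrite addSn qbinomS IH; last by lia.
rewrite -addSnnS (IH i.+1 j); last by lia.
by rewrite (addnC i.+1) qbinomS_alt; ring.
Qed.

(** The q-Pochhammer symbol $(q^{j+1};q)_k$. *)
Definition qprod (j k : nat) : R := \prod_(l < k) (1 - q ^+ (j + l.+1)).

Lemma qprod_add j k l : qprod j (k + l) = qprod j k * qprod (j + k) l.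
Proof.
rewrite /qprod big_split_ord /=; congr (_ * _).
by apply: eq_bigr => i _; rewrite -addnS addnA.
Qed.

Lemma qprod_mod j k : exists r, qprod j k = 1 + q ^+ j.+1 * r.
Proof.
elim: k => [|k [r IH]]; first by exists 0; rewrite /qprod big_ord0 mulr0 addr0.
exists (r - q ^+ k - q ^+ (j.+1 + k) * r).
rewrite /qprod big_ord_recr /= -/(qprod j k) IH -addSnnS exprD; ring.
Qed.

(** Eliminates [qbinom (k + j) k.+1] between the two q-Pascal rules. *)
Lemma qbinom_mul_step k j :
  (1 - q ^+ k.+1) * qbinom (k + j).+1 k.+1
  = (1 - q ^+ (k + j).+1) * qbinom (k + j) k.
Proof.
rewrite mulrBl mul1r {1}qbinomS qbinomS_alt -addSn exprD; ring.
Qed.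

Lemma qbinom_qprod k j : qprod 0 k * qbinom (k + j) k = qprod j k.
Proof.
elim: k => [|k IH]; first by rewrite /qprod !big_ord0 qbinom0 mulr1.
rewrite /qprod !big_ord_recr /= -!/(qprod _ _) -mulrA.
by rewrite qbinom_mul_step -IH addnS (addnC j); ring.
Qed.

(** The product is [qprod M k * qprod k n], whose factors are 1 modulo $q^{M+1}$ and $q^{k+1}$. The
    explicit [r] expresses the congruence in any ring. *)
Lemma qbinom_approx k n M : (k + n <= M)%N ->
  exists r, qprod 0 (k + n) * qbinom (k + M) k = 1 + q ^+ k.+1 * r.
Proof.
move=> knM; rewrite qprod_add mulrAC qbinom_qprod add0n.
have [r ->] := qprod_mod M k; have [s ->] := qprod_mod k n.
exists (s + q ^+ (M - k) * r * (1 + q ^+ k.+1 * s)).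
rewrite (_ : M.+1 = (M - k + k.+1)%N); last by lia.
by rewrite exprD; ring.
Qed.

(* These two recurrences compare the coefficients of [chebV n] on both sides of
   [theta_prod m.+1 = (1 - y q^(m+1) + q^(2m+2)) * theta_prod m] below. *)
Lemma qbinom_rec0 m : qbinom m.*2.+3 m.+2
  = (1 + q ^+ m.+1 + q ^+ m.*2.+2) * qbinom m.*2.+1 m.+1
    + q ^+ m.+2 * qbinom m.*2.+1 m.+2.
Proof.
have E : (m.*2.+1 = m + m.+1)%N by lia.
have E' : (m.*2.+1 = m.+1 + m)%N by lia.
rewrite qbinomS {1}E qbinomS_alt qbinom_sym -E E' qbinomS_alt -E'.
rewrite !exprS -addnn exprD; ring.
Qed.

Lemma qbinom_rec m n : q ^+ n.+1 * qbinom m.*2.+3 (m + n).+3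
  = (1 + q ^+ m.*2.+2) * (q ^+ n.+1 * qbinom m.*2.+1 (m + n).+2)
    + q ^+ m.+1 * (qbinom m.*2.+1 (m + n).+1
                   + q ^+ n.*2.+3 * qbinom m.*2.+1 (m + n).+3).
Proof.
have [mn|nm] := ltnP m n.
  by rewrite !qbinom_small ?(mulr0, addr0) //; lia.
rewrite qbinomS.
have -> : qbinom m.*2.+2 (m + n).+2
    = q ^+ (m - n) * qbinom m.*2.+1 (m + n).+1 + qbinom m.*2.+1 (m + n).+2.
  have -> : m.*2.+1 = ((m + n).+1 + (m - n))%N by lia.
  exact: qbinomS_alt.
have A : q ^+ (m + n).+3 * q ^+ n.+1 * qbinom m.*2.+2 (m + n).+3
    = q ^+ m.*2.+2 * q ^+ n.+1 * qbinom m.*2.+1 (m + n).+2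
      + q ^+ (m + n).+3 * q ^+ n.+1 * qbinom m.*2.+1 (m + n).+3.
  (* For [n = m] the exponent [(m - n).-1] used below would truncate, but then every binomial here
     vanishes. *)
  case: (ltngtP n m) nm => // [nm _|-> _]; last first.
    by rewrite !qbinom_small ?(mulr0, addr0) //; lia.
  rewrite {1}(_ : m.*2.+1 = ((m + n).+2 + (m - n).-1)%N); last by lia.
  rewrite qbinomS_alt (_ : ((m + n).+2 + (m - n).-1)%N = m.*2.+1); last by lia.
  rewrite (_ : m.*2.+2 = ((m + n).+3 + (m - n).-1)%N); last by lia.
  by rewrite exprD; ring.
have -> (a b c d : R) : a * (b + c * d) = a * b + c * a * d by ring.
rewrite A mulrDr mulrA -exprD (_ : (n.+1 + (m - n))%N = m.+1); last by lia.
rewrite -(exprD q (m + n).+3).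
rewrite (_ : ((m + n).+3 + n.+1)%N = (m.+1 + n.*2.+3)%N); last by lia.
rewrite exprD; ring.
Qed.
End GaussianBinomial.

(** * A finite form of Jacobi's triple product *)

Section TripleProduct.
Variables (R : comNzRingType) (q y : R).

(** For $y = z + 1/z$ this is $z^{-n} + \dots + z^n$; the recurrence avoids adjoining $z$. *)
Fixpoint chebV (n : nat) : R :=
  if n is n'.+1 then (if n' is n''.+1 then y * chebV n' - chebV n'' else y + 1)
  else 1.

Arguments chebV : simpl never.

Lemma chebV0 : chebV 0 = 1. Proof. by []. Qed.
Lemma chebV1 : chebV 1 = y + 1. Proof. by []. Qed.

Lemma chebVSS n : chebV n.+2 = y * chebV n.+1 - chebV n.
Proof. by []. Qed.

(** As $y^3 - 3y = z^3 + z^{-3}$, this is the recurrence for $z^3$ along a residue class of indices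
    modulo 3. *)
Lemma chebVS6 n :
  chebV n.+4.+2 = (y ^+ 3 - 3%:R * y) * chebV n.+3 - chebV n.
Proof. by rewrite !chebVSS; ring. Qed.

Definition jacobi_coef (n : nat) : R := (-1) ^+ n * q ^+ 'C(n.+1, 2).

(** The q-binomial theorem for the $2m+1$ factors $1 - zq^j$, $-m \le j \le m$, pairs its terms into
    these coefficients of $V_n$ after division by $1 - z$. *)
Definition jacobi_fin (m n : nat) : R :=
  jacobi_coef n * qbinom q m.*2.+1 (m + n).+1.

(** Since $yV_0 = V_1 - V_0$, the missing lower neighbour is replaced by [- jacobi_fin m 0]. *)
Lemma jacobi_finS0 m : jacobi_fin m.+1 0
  = (1 + q ^+ m.*2.+2) * jacobi_fin m 0
    - q ^+ m.+1 * (- jacobi_fin m 0 + jacobi_fin m 1).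
Proof.
rewrite /jacobi_fin /jacobi_coef !addn0 addn1 doubleS qbinom_rec0 !binS !bin0n.
by rewrite !exprS; ring.
Qed.

Lemma jacobi_finS m n : jacobi_fin m.+1 n.+1
  = (1 + q ^+ m.*2.+2) * jacobi_fin m n.+1
    - q ^+ m.+1 * (jacobi_fin m n + jacobi_fin m n.+2).
Proof.
rewrite /jacobi_fin /jacobi_coef doubleS !addnS addSn.
have T1 : 'C(n.+2, 2) = ('C(n.+1, 2) + n.+1)%N by rewrite binS bin1.
have T2 : 'C(n.+3, 2) = ('C(n.+1, 2) + n.*2.+3)%N.
  by rewrite binS T1 bin1; lia.
rewrite T1 T2; move: 'C(n.+1, 2) => t; rewrite !exprD.
have -> (a b c d : R) : a * (b * c) * d = a * b * (c * d) by ring.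
rewrite qbinom_rec 3![(-1) ^+ _.+1]exprS; ring.
Qed.

Lemma jacobi_fin_small m n : (m < n)%N -> jacobi_fin m n = 0.
Proof. by move=> mn; rewrite /jacobi_fin qbinom_small ?mulr0 //; lia. Qed.

(* Summation by parts, with [chebV (-1) = - chebV 0] at the lower end. *)
Lemma jacobi_fin_telescope m N :
  \sum_(n < N.+1) (jacobi_fin m.+1 n - (1 + q ^+ m.*2.+2) * jacobi_fin m n
      + q ^+ m.+1 * y * jacobi_fin m n) * chebV n
  = q ^+ m.+1 * (jacobi_fin m N * chebV N.+1 - jacobi_fin m N.+1 * chebV N).
Proof.
elim: N => [|N IH].
  by rewrite big_ord1 chebV0 chebV1 /= jacobi_finS0; ring.
  by rewrite big_ord_recr /= IH jacobi_finS chebVSS; ring.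
Qed.

Definition theta_prod (m : nat) : R :=
  \prod_(j < m) (1 - y * q ^+ j.+1 + q ^+ j.+1.*2).

(** [N] stays free so that the expansions for [m] and [m.+1] share one range; the boundary terms of
    the telescoped sum then vanish. *)
Lemma theta_prodE m N : (m < N)%N ->
  theta_prod m = \sum_(n < N) jacobi_fin m n * chebV n.
Proof.
elim: m N => [|m IH] [|N] // mN.
  rewrite /theta_prod big_ord0 big_ord_recl big1 => [|i _].
    by rewrite /jacobi_fin /jacobi_coef chebV0 (qbinom_diag q 1) !expr0 !mulr1
      addr0.
  by rewrite jacobi_fin_small ?mul0r.
rewrite /theta_prod big_ord_recr -/(theta_prod m) (IH N.+1) ?(ltnW mN) //=.
have := jacobi_fin_telescope m N.
have -> : jacobi_fin m N = 0 by apply: jacobi_fin_small; lia.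
have -> : jacobi_fin m N.+1 = 0 by apply: jacobi_fin_small; lia.
rewrite !mul0r subrr mulr0 => tele.
apply/esym/eqP; rewrite -subr_eq0; apply/eqP; rewrite -[RHS]tele.
rewrite mulr_suml -sumrB; apply: eq_bigr => i _.
by rewrite doubleS; ring.
Qed.

(** Jacobi's identity modulo $q^{m+1}$: the binomial in the [n]-th term is only controlled modulo
    $q^{m-n+1}$, and the factor $q^{n(n+1)/2}$ makes up for the missing $q^n$. *)
Lemma jacobi_approx m : exists r,
  qprod q 0 m * theta_prod m
  = \sum_(n < m.+1) jacobi_coef n * chebV n + q ^+ m.+1 * r.
Proof.
rewrite (theta_prodE (ltnSn m)) mulr_sumr.
elim/big_rec2: _ => [|n a b _ [r ->]]; first by exists 0; rewrite mulr0 addr0.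
have nm : (n <= m)%N by rewrite -ltnS.
have [s Es] : exists s, qprod q 0 m * qbinom q m.*2.+1 (m + n).+1
    = 1 + q ^+ (m - n).+1 * s.
  have [|s] := @qbinom_approx R q (m - n) n (m + n).+1; first by lia.
  rewrite qbinom_sym subnK //.
  rewrite (_ : (m - n + (m + n).+1)%N = m.*2.+1); last by lia.
  by exists s.
have Tn : (n <= 'C(n.+1, 2))%N by rewrite binS bin1 leq_addl.
exists (r + (-1) ^+ n * q ^+ ('C(n.+1, 2) - n) * s * chebV n).
have -> : qprod q 0 m * (jacobi_fin m n * chebV n)
    = jacobi_coef n * (qprod q 0 m * qbinom q m.*2.+1 (m + n).+1) * chebV n.
  by rewrite /jacobi_fin; ring.
have Eq : q ^+ 'C(n.+1, 2) * q ^+ (m - n).+1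
    = q ^+ m.+1 * q ^+ ('C(n.+1, 2) - n).
  by rewrite -!exprD; congr (_ ^+ _); lia.
rewrite Es {1}/jacobi_coef.
have -> (u v w x z : R) : u * v * (1 + w * x) * z
    = u * v * z + u * (v * w) * x * z
  by ring.
by rewrite Eq /jacobi_coef; ring.
Qed.
End TripleProduct.

(** * The polynomials $V_{3m+1}$ in characteristic 3 *)

Section CharacteristicThree.
Variables (B : comNzRingType) (B3 : 3%:R = 0 :> B).
Let y : {poly B} := - (1 + 'X).

Lemma cubic_char3 : y ^+ 3 - 3%:R * y = - (1 + 'X^3).
Proof.
have P3 : 3%:R = 0 :> {poly B} by rewrite -polyC_natr B3.
(* The cross terms of the cube are added on the right as a multiple of [3%:R], leaving an identity
   that holds over the integers. *)
rewrite P3 mul0r subr0 -[RHS]subr0 -(mul0r ('X^2 + 'X)) -P3 /y; ring.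
Qed.

(** $V_1 = -X$, and multiplication by $-(1 + X^3)$ preserves exponents modulo 3. The recurrence has
    order two, so two consecutive values are carried along. *)
Lemma coef_chebV_char3 m t : (t %% 3 != 1)%N -> (chebV y (3 * m + 1))`_t = 0.
Proof.
suff H (k : nat) : (forall t, (t %% 3 != 1)%N -> (chebV y (3 * k + 1))`_t = 0)
  /\ (forall t, (t %% 3 != 1)%N -> (chebV y (3 * k + 4))`_t = 0).
  by move=> t3; case: (H m) => -> .
have shift (p : {poly B}) u : (u %% 3 != 1)%N ->
    (forall t, (t %% 3 != 1)%N -> p`_t = 0) -> (- (1 + 'X^3) * p)`_u = 0.
  move=> u3 p0; rewrite mulNr mulrDl mul1r coefN coefD coefXnM p0 //.
  case: ltnP => [_|u_ge3]; first by rewrite addr0 oppr0.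
  by rewrite p0 ?addr0 ?oppr0 //; lia.
have base u : (u %% 3 != 1)%N -> (chebV y 1)`_u = 0.
  rewrite chebV1 /y => u3.
  rewrite (_ : - (1 + 'X) + 1 = - 'X :> {poly B}); last by ring.
  rewrite coefN coefX; case: eqP => [u1|_]; last exact: oppr0.
  by rewrite u1 in u3.
elim: k => [|k [IH1 IH4]].
  split=> // u u3.
  (* This is [chebVS6] continued to index $-2$, where $V_{-2} = -V_1$. *)
  have -> : chebV y (3 * 0 + 4)
      = (y ^+ 3 - 3%:R * y) * chebV y 1 + chebV y 1.
    by rewrite !chebVSS chebV1 chebV0; ring.
  by rewrite cubic_char3 coefD base // shift // addr0.
split=> u u3; first by rewrite (_ : (3 * k.+1 + 1 = 3 * k + 4)%N) ?IH4 //; lia.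
have -> : (3 * k.+1 + 4 = (3 * k + 1).+4.+2)%N by lia.
rewrite chebVS6 cubic_char3 coefB IH1 // subr0 shift //.
by move=> v v3; rewrite (_ : (3 * k + 1).+3 = 3 * k + 4)%N ?IH4 //; lia.
Qed.
End CharacteristicThree.

(** * Increasing sequences and elementary symmetric functions *)

Fixpoint strict_seqs (M t : nat) : seq (seq nat) :=
  match t, M with
  | 0%N, _ => [:: [::]]
  | _.+1, 0%N => [::]
  | t'.+1, M'.+1 =>
      strict_seqs M' t ++ [seq rcons s M | s <- strict_seqs M' t']
  end.

Lemma path_ltn_le_last a s : path ltn a s -> all (leq^~ (last a s)) (a :: s).
Proof.
elim: s a => [|b s IH] a /=; first by rewrite leqnn.
case/andP=> ab /IH /= /andP[b_le ->].
by rewrite b_le (leq_trans (ltnW ab) b_le).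
Qed.

Lemma mem_strict_seqs M t s : (s \in strict_seqs M t)
  = [&& size s == t, path ltn 0%N s & all (leq^~ M) s].
Proof.
elim: M t s => [|M IH] [|t] s; rewrite ?inE; try by case: s.
- by case: s => [|[|x] s] //=; rewrite ?in_nil ?andbF. 
- case/lastP: s => [|s x].
    rewrite /= mem_cat IH /=; apply/negbTE/mapP => -[s _ /(congr1 size)].
    by rewrite size_rcons.
  have -> : (rcons s x \in strict_seqs M.+1 t.+1)
      = (rcons s x \in strict_seqs M t.+1)
        || (x == M.+1) && (s \in strict_seqs M t).
    rewrite /= mem_cat; congr (_ || _).
    apply/mapP/andP => [[s' s's /rcons_inj[-> ->]]|[/eqP-> sM]].
      by rewrite eqxx.
    by exists s.
  rewrite !IH size_rcons eqSS rcons_path !all_rcons.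
  case: (size s == t); rewrite //= ?andbF //.
  case: (boolP (path ltn 0%N s)) => //= [sp|_]; rewrite ?andbF //=.
  have /= s_last := path_ltn_le_last sp.
  have all_le k : all (leq^~ k) s = (last 0%N s <= k)%N.
    apply/idP/idP => [|ls].
      by case: (s) => [|b s'] // sk; exact: (allP sk _ (mem_last b s')).
    by apply: sub_all s_last => z /= zl; exact: leq_trans ls.
  rewrite !all_le; move: (last 0%N s) => l {IH sp s_last all_le}.
  rewrite [(x <= M.+1)%N]leq_eqVlt ltnS; case: eqVneq => [->|_].
    by rewrite ltnn ltnS /=; case: leqP => [lM|//]; rewrite (leqW lM).
  rewrite orbF /=; case: (ltnP l x) => //= lx; case: (leqP x M) => //= xM.
  have lM : (l <= M)%N by exact: leq_trans (ltnW lx) xM.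
  by rewrite lM leqW.
Qed.

Lemma strict_seqs_uniq M t : uniq (strict_seqs M t).
Proof.
elim: M t => [|M IH] [|t] //=.
rewrite cat_uniq IH map_inj_uniq ?IH ?andbT /=; last first.
  by move=> s s' /rcons_inj[].
apply/hasPn => s /mapP[s' _ ->].
by rewrite mem_strict_seqs all_rcons ltnn !andbF.
Qed.

(** Choosing ['X] or 1 in the last factor mirrors whether [M] ends the sequence. *)
Lemma coef_prod_strict_seqs (R : comNzRingType) (c : nat -> R) M t :
  (\prod_(i < M) (1 + (c i.+1)%:P * 'X))`_t
  = \sum_(s <- strict_seqs M t) \prod_(m <- s) c m.
Proof.
elim: M t => [|M IH] t.
  rewrite big_ord0 coef1; case: t => [|t] /=; last by rewrite big_nil.
  by rewrite big_seq1 big_nil.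
rewrite big_ord_recr /= mulrDr mulr1 coefD IH mulrA coefMX; case: t => [|t] /=.
  by rewrite addr0; case: (M).
rewrite coefMC IH big_cat /= big_map mulr_suml; congr (_ + _).
by apply: eq_bigr => s _; rewrite big_rcons /= mulrC.
Qed.

(** * Reduction of coefficients modulo a prime *)

Section FpsMap.
Variables (R S : comUnitRingType) (f : {rmorphism R -> S}).

Definition fps_map (g : fps R) : fps S := Fps (fun n => f (g n)).

Fact fps_map_is_zmod_morphism : zmod_morphism fps_map.
Proof. by move=> g h; apply: fpsP => n; exact: rmorphB. Qed.

Fact fps_map_is_monoid_morphism : monoid_morphism fps_map.
Proof.
split; first by apply: fpsP => n /=; case: ifP => _; rewrite ?rmorph1 ?rmorph0.
move=> g h; apply: fpsP => n /=; rewrite rmorph_sum.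
by apply: eq_bigr => i _; rewrite rmorphM.
Qed.

HB.instance Definition _ := GRing.isZmodMorphism.Build (fps R) (fps S)
  fps_map fps_map_is_zmod_morphism.
HB.instance Definition _ := GRing.isMonoidMorphism.Build (fps R) (fps S)
  fps_map fps_map_is_monoid_morphism.

Lemma fps_map_q : fps_map (fps_q R) = fps_q S.
Proof. by apply: fpsP => n /=; case: ifP => _; rewrite ?rmorph1 ?rmorph0. Qed.
End FpsMap.

Definition MO_summand (R : comUnitRingType) (q : R) (m : nat) : R :=
  q ^+ m / (1 + q ^+ m + q ^+ (2 * m)).

(** A sequence with an entry above [n] has sum above [n], so its term does not reach $q^n$. *)
Lemma MO_strict_seqs a t n : MO a t n
  = \sum_(s <- strict_seqs n t)
      (fps_q int ^+ (\sum_(m <- s) m)%N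
        / \prod_(m <- s) (1 + a%:~R * fps_q int ^+ m + fps_q int ^+ (2 * m))) n.
Proof.
pose r : seq (t.-tuple nat) := pmap insub (strict_seqs n t).
have mem_r (s : t.-tuple nat) : (s \in r) = path ltn 0%N s && all (leq^~ n) s.
  by rewrite mem_pmap_sub mem_strict_seqs size_tuple eqxx.
have vr : map val r = strict_seqs n t.
  rewrite /r pmap_filter; last exact: insubK.
  apply/all_filterP/allP => s; rewrite mem_strict_seqs => /andP[st _].
  by case: insubP => [//|]; rewrite st.
rewrite -vr big_map /MO /MO_gf /= (@fsbigE _ _ _ _ _ r) /=.
- rewrite [LHS]big_seq_cond [RHS]big_seq; apply: eq_bigl => s.
  rewrite andb_idr // mem_r => /andP[ps _]; exact/mem_set.
- by rewrite pmap_sub_uniq // strict_seqs_uniq.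
- by move=> s /=; rewrite mem_r => /andP[].
move=> s ps; rewrite mem_r (ps : path _ _ _) /= => /allPn[m ms nm].
apply: MO_term_lt; rewrite (big_rem m) //=.
by rewrite (leq_trans _ (leq_addr _ _)) // ltnNge.
Qed.

(** Reduction commutes with the quotients because positive entries make all denominators units. *)
Lemma MO_mod (p t n : nat) :
  (MO 1 t n)%:~R = (\sum_(s <- strict_seqs n t)
     \prod_(m <- s) MO_summand (fps_q 'F_p) m) n :> 'F_p.
Proof.
rewrite MO_strict_seqs rmorph_sum fps_bigE big_seq [RHS]big_seq.
apply: eq_bigr => s; rewrite mem_strict_seqs => /and3P[_ ps _].
pose phi := fps_map (intr : {rmorphism int -> 'F_p}).
have s_gt0 m : m \in s -> (0 < m)%N.
  by move: ps; rewrite (path_sortedE ltn_trans) => /andP[/allP h _] /h.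
set u := fps_q int; rewrite -[LHS]/(phi (_ / _) n); congr (fps_coef _ n).
have phid m : phi (1 + 1%:~R * u ^+ m + u ^+ (2 * m))
    = 1 + fps_q 'F_p ^+ m + fps_q 'F_p ^+ (2 * m).
  by rewrite /phi !(rmorphD, rmorphM, rmorph1, rmorphXn) /= fps_map_q mul1r.
have den : {in s, forall m, 1 + 1%:~R * u ^+ m + u ^+ (2 * m) \is a GRing.unit}.
  by move=> m /s_gt0; exact: (MO_denom_unit 1).
elim: s {ps s_gt0} den => [|m s IH] den.
  by rewrite !big_nil divr1 /phi rmorph1.
have Um : 1 + 1%:~R * u ^+ m + u ^+ (2 * m) \is a GRing.unit.
  by apply: den; rewrite mem_head.
have Us : \prod_(k <- s) (1 + 1%:~R * u ^+ k + u ^+ (2 * k)) \is a GRing.unit.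
  by rewrite big_seq rpred_prod // => k ks; apply: den; rewrite inE ks orbT.
rewrite !big_cons -IH => [|k ks]; last by apply: den; rewrite inE ks orbT.
rewrite /MO_summand -phid -(fps_map_q (intr : {rmorphism int -> 'F_p})) -/phi.
rewrite -rmorphXn -rmorphV // -!rmorphM exprD invrM //; congr (phi _).
by rewrite [RHS]mulrACA [X in _ = _ * X]mulrC.
Qed.

(** * Power series in $q^d$ *)

Section Spread.
Variable R : comUnitRingType.
Implicit Types f g : fps R.

Definition spread (d : nat) f := forall n, ~~ (d %| n)%N -> f n = 0.

Lemma spread1 d : spread d 1.
Proof. by case=> [|n]; rewrite ?dvdn0. Qed.

Lemma spread0 d : spread d 0.
Proof. by move=> n _ /=; case: ifP. Qed.

Lemma spreadB d f g : spread d f -> spread d g -> spread d (f - g).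
Proof. by move=> sf sg n dn; rewrite fpsB sf // sg // subrr. Qed.

Lemma spreadM d f g : spread d f -> spread d g -> spread d (f * g).
Proof.
move=> sf sg n dn; rewrite fpsM big1 // => i _.
have [di|/sf->] := boolP (d %| i)%N; last by rewrite mul0r.
rewrite sg ?mulr0 //; apply: contra dn => dni.
by rewrite -(subnKC (ltn_ord i : i <= n)%N) dvdn_add.
Qed.

Lemma spreadX d k : (d %| k)%N -> spread d (fps_q R ^+ k).
Proof.
move=> dk n dn; rewrite -[_ ^+ _]mulr1 fps_qXM fps1; case: ltnP => // kn.
case: eqP => // /eqP; rewrite subn_eq0 => nk.
by move: dn; rewrite (_ : n = k) ?dk //; apply/eqP; rewrite eqn_leq nk.
Qed.

(** Strong induction: in the coefficient of $q^n$ in [g * f], each term but [f n] has a factor [g i]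
    with $d \nmid i$ or an earlier [f (n - i)] with $d \nmid n - i$. *)
Lemma spread_div d f g h r M : spread d g -> g 0%N = 1 -> spread d h ->
  g * f = h + fps_q R ^+ M * r ->
  forall n, (n < M)%N -> ~~ (d %| n)%N -> f n = 0.
Proof.
move=> sg g0 sh E; elim/ltn_ind=> n IH nM dn.
have := congr1 (fun F : fps R => F n) E.
rewrite -[RHS]/(h n + (fps_q R ^+ M * r) n) fps_qXM nM sh // addr0.
rewrite fpsM big_ord_recl g0 mul1r subn0 big1 ?addr0 // => i _ /=.
rewrite /bump leq0n add1n.
have [di|/sg->] := boolP (d %| i.+1)%N; last by rewrite mul0r.
have i_lt := ltn_ord i; rewrite IH ?mulr0 //; [by lia | by lia |].
by apply: contra dn => /dvdn_add /(_ di); rewrite subnK.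
Qed.
End Spread.

(** These coefficients are integer constants, free of $q$. *)
Lemma coef_chebV_spread (R : comUnitRingType) d n t :
  spread d (chebV (- (1 + 'X) : {poly fps R}) n)`_t.
Proof.
have opp f : spread d f -> spread d (- f :> fps R).
  by rewrite -sub0r; apply: spreadB; exact: spread0.
elim/ltn_ind: n t => -[|[|n]] IH t.
- rewrite chebV0 coef1; case: eqP => _; [exact: spread1 | exact: spread0].
- rewrite chebV1 (_ : - (1 + 'X) + 1 = - 'X :> {poly fps R}); last by ring.
  rewrite coefN coefX; apply: opp.
  by case: eqP => _; [exact: spread1 | exact: spread0].
rewrite chebVSS coefB mulNr mulrDl mul1r coefN coefD coefXM.
apply: spreadB; last by apply: IH; lia.
rewrite opprD; apply: spreadB; first by apply: opp; apply: IH.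
by case: eqP => _; [exact: spread0 | apply: IH].
Qed.

Lemma MO_denom1_unit (R : comUnitRingType) m : (0 < m)%N ->
  1 + fps_q R ^+ m + fps_q R ^+ (2 * m) \is a GRing.unit.
Proof.
move=> m0; set f := (X in X \is a _).
suff f0 : f 0%N = 1 by change (f 0%N \is a GRing.unit); rewrite f0 unitr1.
have q0 k : (0 < k)%N -> (fps_q R ^+ k) 0%N = 0.
  by move=> k0; rewrite -[_ ^+ _]mulr1 fps_qXM k0.
by rewrite /f /= !q0 ?addr0 // muln_gt0.
Qed.

(** * The generating function and its coefficients modulo 3 *)

Lemma MO_product (R : comUnitRingType) (M : nat) (q := fps_q R) :
  qprod (q%:P) 0 M * theta_prod (q%:P) (- (1 + 'X)) M
  = (\prod_(i < M) (1 - q ^+ (3 * i.+1)))%:P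
    * \prod_(i < M) (1 + (MO_summand q i.+1)%:P * 'X) :> {poly fps R}.
Proof.
rewrite rmorph_prod /qprod /theta_prod -!big_split /=.
apply: eq_bigr => i _; rewrite add0n.
have := MO_denom1_unit R (ltn0Sn i); rewrite -/q; move: i.+1 => {i} k /divrK.
move=> /(_ (q ^+ k)) /(congr1 (fun f : fps R => f%:P)).
rewrite -/(MO_summand q k); move: (MO_summand q k) => c.
rewrite -muln2 (mulnC 2) (mulnC 3) !exprM.
rewrite !(rmorphB, rmorphD, rmorphM, rmorphXn, rmorph1) /=.
move: (q%:P ^+ k) => u E.
(* The factor $1 + u + u^2$ of $1 - u^3$ clears the denominator of [c]; [E] then turns its product
   with [c%:P] into [u]. *)
have -> : (1 - u ^+ 3) * (1 + c%:P * 'X)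
    = (1 - u) * (1 + u + u ^+ 2 + c%:P * (1 + u + u ^+ 2) * 'X) by ring.
by rewrite E; ring.
Qed.

(** With [n] factors the error in Jacobi's identity is a multiple of $q^{n+1}$, so the coefficient
    of $q^n$ is exact. *)
Lemma elementary_summand_spread t n (q := fps_q 'F_3) :
  (t %% 3 != 1)%N -> ~~ (3 %| n)%N ->
  (\sum_(s <- strict_seqs n t) \prod_(m <- s) MO_summand q m) n = 0.
Proof.
move=> t3 n3; rewrite -(coef_prod_strict_seqs (MO_summand q)).
have B3 : 3%:R = 0 :> fps 'F_3.
  have -> : 3%:R = 1 + 1 + 1 :> fps 'F_3 by ring.
  apply: fpsP => k /=.
  by case: ifP => _; rewrite ?addr0 //; apply/val_inj.
have [r] := jacobi_approx (q%:P) (- (1 + 'X)) n.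
rewrite MO_product => /(congr1 (fun p : {poly fps 'F_3} => p`_t)).
rewrite coefCM coefD -polyC_exp coefCM [X in _ = X + _]coef_sum.
set D := \prod_(i < n) _ => E.
have sD : spread 3 D.
  rewrite /D; elim/big_rec: _ => [|i f _ sf]; first exact: spread1.
  apply: spreadM => //; apply: spreadB; first exact: spread1.
  by apply: spreadX; rewrite dvdn_mulr.
have D0 : D 0%N = 1.
  rewrite /D; elim/big_rec: _ => [//|i f _ f0].
  rewrite fpsM big_ord1 f0 mulr1 fpsB -[_ ^+ _]mulr1 fps_qXM subr0 //.
apply: (spread_div sD D0 _ E) => //.
move=> k k3; rewrite fps_bigE big1 // => i _.
have -> : jacobi_coef (q%:P) i = ((-1) ^+ i * q ^+ 'C(i.+1, 2))%:P.
  by rewrite /jacobi_coef rmorphM !rmorphXn rmorphN1.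
rewrite coefCM; have [i3|i3] := eqVneq (i %% 3)%N 1%N.
  have -> : (i : nat) = (3 * (i %/ 3) + 1)%N by lia.
  by rewrite (coef_chebV_char3 B3) // mulr0; exact: spread0 k3.
apply: spreadM k3; last exact: coef_chebV_spread.
apply: spreadM.
  rewrite -signr_odd; case: odd; last exact: spread1.
  rewrite expr1 -sub0r; apply: spreadB; [exact: spread0 | exact: spread1].
apply: spreadX; rewrite bin2 /=.
have d3 : (3 %| i.+1 * i)%N.
  have [i0|i2] : (3 %| i)%N \/ (3 %| i.+1)%N by lia.
    by rewrite dvdn_mull.
  by rewrite dvdn_mulr.
(* Evenness makes the halving in [bin2] exact, so divisibility by 3 passes to the half. *)
have : ~~ odd (i.+1 * i) by rewrite oddM /= andNb.
by move: (i.+1 * i)%N d3 => m; lia.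
Qed.

Theorem theorem3p1 (J N : nat) :
  (MO 1 (3 * J + 3) (3 * N + 1) = MO 1 (3 * J + 2) (3 * N + 1) %[mod 3])%Z
  /\ (MO 1 (3 * J + 2) (3 * N + 1) = 0 %[mod 3])%Z.
Proof.
(* Both orders, being 0 and 2 modulo 3, are covered by one vanishing statement. *)
have MO0 t : (t %% 3 != 1)%N -> (MO 1 t (3 * N + 1) = 0 %[mod 3])%Z.
  move=> t3; apply/eqP; rewrite eqz_mod_dvd subr0.
  rewrite (@dvdz_pcharf 'F_3 3) ?pchar_Fp // MO_mod.
  by rewrite elementary_summand_spread //; lia.
by rewrite !MO0 //; lia.
Qed.
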